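(* Fix a switching cost $c\ge 0$, and for each penalty parameter $\rho\ge0$ let $u^\rho\in\mathbb R^{N\times d}$ be the (unique) solution of the penalized problem $$F_i(u^{\rho})_l-\rho\sum_{j\neq i}\pi\big(u^{\rho,j}_l-c-u^{\rho,i}_l\big)=0,\qquad i\in\mathcal I,\ l\in\mathcal N.$$ Then $u^\rho$ converges monotonically from below to some $u\in\mathbb R^{N\times d}$ as $\rho\to\infty$. Moreover, if $c>0$, then $u$ solves the quasi-variational inequality $$\min\big(F_i(u),\,u^i-\mathcal M_iu\big)=0,\qquad i\in\mathcal I .$$
   Context: Let $N\ge1$ and $d\ge 2$ be integers, $\mathcal I=\{1,\dots,d\}$, $\mathcal N=\{1,\dots,N\}$. An element $u\in\mathbb R^{N\times d}$ is written $u=(u^1,\dots,u^d)$ with $u^i\in\mathbb R^N$ and entries $u^i_l$. Inequalities, minima and maxima of vectors/matrices are understood elementwise, and adding or subtracting a scalar acts on every entry. ''Monotonically from below'' means that $u^{\rho_1}\ge u^{\rho_2}$ whenever $\rho_1\ge\rho_2\ge0$ (so $u^\rho$ increases to its limit). $F=(F_i)_{i\in\mathcal I}:\mathbb R^{N\times d}\to\mathbb R^{N\times d}$ (with $F_i(u)\in\mathbb R^N$) is a continuous function satisfying the monotonicity condition: there is a constant $\gamma>0$ such that for any $u,v\in\mathbb R^{N\times d}$, $i\in\mathcal I$, $l\in\mathcal N$ with $u^i_l-v^i_l=\max_{j\in\mathcal I,k\in\mathcal N}(u^j_k-v^j_k)\ge 0$, one has $F_i(u)_l-F_i(v)_l\ge\gamma(u^i_l-v^i_l)$.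 $\mathcal M_iu:=\max_{j\ne i}(u^j-c)\in\mathbb R^N$. The penalty function $\pi:\mathbb R\to\mathbb R$ is a continuous non-decreasing function with $\pi|_{(-\infty,0]}=0$ and $\pi|_{(0,\infty)}>0$. For every $\rho\ge0$, $c\ge0$ the penalized problem has a unique solution. *)

(* Defs.v *)
From HB Require Import structures.
From mathcomp Require Import all_boot all_order all_algebra.
From mathcomp Require Import all_classical all_reals all_analysis.

Set Implicit Arguments.
Unset Strict Implicit.
Unset Printing Implicit Defensive.

Import Order.TTheory GRing.Theory Num.Theory.
Import numFieldNormedType.Exports.

Local Open Scope classical_set_scope.
Local Open Scope ring_scope.

(* An element u = (u^1, ..., u^d) of R^(N x d) is a matrix u : 'M[R]_(N, d);
   its i-th column is u^i, so the entry u^i_l is u l i. *)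

(* A max over an index set without a default element: for a nonempty P it is
   the largest of the F i with P i (see fmaxP); for an empty P it is 0. *)
Definition fmax (R : realType) (I : finType) (P : pred I) (F : I -> R) : R :=
  sup [set F i | i in [set i | P i]].

Lemma fmaxP (R : realType) (I : finType) (P : pred I) (F : I -> R) (i0 : I) :
  P i0 ->
  (exists2 i, P i & fmax P F = F i) /\ (forall i, P i -> F i <= fmax P F).
Proof.
move=> Pi0; case: (@Order.TotalTheory.arg_maxP _ _ _ i0 P F Pi0) => i Pi Fi.
suff -> : fmax P F = F i by split; [exists i | move=> j /Fi].
apply/eqP; rewrite eq_le; apply/andP; split.
  by apply: ge_sup; [exists (F i0), i0 | move=> _ [j Pj <-]; exact: Fi].
apply: ub_le_sup; last by exists i.
by exists (F i) => _ [j Pj <-]; exact: Fi.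
Qed.

Definition monotonicity_condition (R : realType) (N d : nat)
    (F : 'M[R]_(N, d) -> 'M[R]_(N, d)) : Prop :=
  exists2 gamma : R, 0 < gamma &
    forall (u v : 'M[R]_(N, d)) (i : 'I_d) (l : 'I_N),
      u l i - v l i =
        fmax predT (fun jk : 'I_d * 'I_N => u jk.2 jk.1 - v jk.2 jk.1) ->
      0 <= u l i - v l i ->
      gamma * (u l i - v l i) <= F u l i - F v l i.

Definition is_penalty (R : realType) (p : R -> R) : Prop :=
  [/\ continuous p,
      {homo p : x y / x <= y},
      (forall x, x <= 0 -> p x = 0) &
      (forall x, 0 < x -> 0 < p x)].

Definition penalized_solution (R : realType) (N d : nat)
    (F : 'M[R]_(N, d) -> 'M[R]_(N, d)) (p : R -> R) (c rho : R)
    (u : 'M[R]_(N, d)) : Prop :=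
  forall (i : 'I_d) (l : 'I_N),
    F u l i - rho * \sum_(j < d | j != i) p (u l j - c - u l i) = 0.

Definition switching_op (R : realType) (N d : nat) (c : R) (i : 'I_d)
    (u : 'M[R]_(N, d)) : 'cV[R]_N :=
  \col_l fmax (fun j : 'I_d => j != i) (fun j => u l j - c).

Definition qvi_solution (R : realType) (N d : nat)
    (F : 'M[R]_(N, d) -> 'M[R]_(N, d)) (c : R) (u : 'M[R]_(N, d)) : Prop :=
  forall i : 'I_d,
    map2_mx Num.min (col i (F u)) (col i u - switching_op c i u) = 0.

Definition cvg_from_below (R : realType) (N d : nat)
    (U : R -> 'M[R]_(N, d)) (u : 'M[R]_(N, d)) : Prop :=
  (forall rho1 rho2 : R, 0 <= rho2 -> rho2 <= rho1 ->
     forall (l : 'I_N) (i : 'I_d), U rho2 l i <= U rho1 l i) /\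
  U rho @[rho --> +oo] --> u.

(* Main.v *)
(** At an entry where [u - v] attains a positive maximum, the penalty terms of
    [u] are dominated by those of [v], while the monotonicity condition makes
    [F u] larger than [F v] there; this yields a comparison principle between
    sub- and supersolutions, monotone in the penalty parameter.  Comparing two
    solutions gives monotonicity of [U], and comparing with a large constant
    matrix gives boundedness, hence the limit [u].  There [0 <= F u] because
    penalties are nonnegative; boundedness of [rho * penalty = F (U rho)] forces
    the obstacle inequality; and where the obstacle inequality is strict the
    penalty eventually vanishes, so [F u = 0]. *)
Require Import Defs.
From HB Require Import structures.
From mathcomp Require Import all_boot all_order all_algebra.
From mathcomp Require Import all_classical all_reals all_analysis.
From mathcomp Require Import lra.

Import Order.TTheory GRing.Theory Num.Theory.
Import numFieldNormedType.Exports.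

Local Open Scope classical_set_scope.
Local Open Scope ring_scope.

(** * Penalty terms and the comparison principle *)

Definition penalty_sum {R : realType} {N d : nat} (p : R -> R) (c : R)
    (u : 'M[R]_(N, d)) (l : 'I_N) (i : 'I_d) : R :=
  \sum_(j < d | j != i) p (u l j - c - u l i).

Lemma penalized_solutionE {R : realType} {N d : nat}
    (F : 'M[R]_(N, d) -> 'M[R]_(N, d)) (p : R -> R) (c rho : R)
    (u : 'M[R]_(N, d)) (l : 'I_N) (i : 'I_d) :
  penalized_solution F p c rho u -> F u l i = rho * penalty_sum p c u l i.
Proof. by move=> /(_ i l) /eqP; rewrite subr_eq0 => /eqP. Qed.

Lemma penalty_ge0 {R : realType} (p : R -> R) (x : R) :
  is_penalty p -> 0 <= p x.
Proof.
case=> _ _ p0 pgt0; have [/p0 ->//|/pgt0 /ltW] := leP x 0.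
by [].
Qed.

Lemma penalty_sum_ge0 {R : realType} {N d : nat} (p : R -> R) (c : R)
    (u : 'M[R]_(N, d)) (l : 'I_N) (i : 'I_d) :
  is_penalty p -> 0 <= penalty_sum p c u l i.
Proof. by move=> hp; apply: sumr_ge0 => j _; exact: penalty_ge0. Qed.

Lemma penalty_sum_eq0 {R : realType} {N d : nat} (p : R -> R) (c : R)
    (u : 'M[R]_(N, d)) (l : 'I_N) (i : 'I_d) : is_penalty p ->
  (forall j, j != i -> u l j - c <= u l i) -> penalty_sum p c u l i = 0.
Proof. by move=> [_ _ p0 _] h; apply: big1 => j /h hj; rewrite p0 ?subr_le0. Qed.

Lemma penalized_comparison {R : realType} {N d : nat}
    (F : 'M[R]_(N, d) -> 'M[R]_(N, d)) (p : R -> R) (c rho1 rho2 : R)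
    (u v : 'M[R]_(N, d)) :
  monotonicity_condition F -> is_penalty p -> 0 <= rho2 -> rho2 <= rho1 ->
  (forall l i, F u l i <= rho2 * penalty_sum p c u l i) ->
  (forall l i, rho1 * penalty_sum p c v l i <= F v l i) ->
  forall l i, u l i <= v l i.
Proof.
move=> [gamma gamma0 Fm] hp rho2_ge0 le_rho subu superv l0 i0.
have [[[i l] _ /= maxE] maxP] :=
  @fmaxP R ('I_d * 'I_N)%type predT (fun jk => u jk.2 jk.1 - v jk.2 jk.1)
    (i0, l0) isT.
rewrite -subr_le0 (le_trans (maxP (i0, l0) isT))// maxE leNgt.
apply/negP => M_gt0.
have /(_ (ltW M_gt0)) := Fm u v i l (esym maxE).
have := subu l i; have := superv l i.
(* Since [u - v] is largest at [(l, i)], each argument [u l j - c - u l i] is at most its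
   counterpart for [v]. *)
have S_le : penalty_sum p c u l i <= penalty_sum p c v l i.
  apply: ler_sum => j _; case: hp => _ p_homo _ _; apply: p_homo.
  have /= := maxP (j, l) isT; rewrite maxE.
  by lra.
have rhoS_le :
    rho2 * penalty_sum p c u l i <= rho1 * penalty_sum p c v l i.
  by apply: ler_pM => //; exact: penalty_sum_ge0.
have := mulr_gt0 gamma0 M_gt0.
by lra.
Qed.

(** A nonnegative constant matrix minus [0] attains its maximum at every entry, so the monotonicity
    condition applies everywhere and gives [F 0 l i + gamma * A <= F (const_mx A) l i]. *)
Lemma const_mx_supersolution {R : realType} {N d : nat}
    (F : 'M[R]_(N, d) -> 'M[R]_(N, d)) :
  monotonicity_condition F ->
  exists A : R, forall l i, 0 <= F (const_mx A) l i.
Proof.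
move=> [gamma gamma0 Fm].
(* [B] dominates every [|F 0 l i|], so [A = B / gamma] offsets the most negative entry of [F 0]. *)
pose B := \sum_(i < d) \sum_(l < N) `|F 0 l i|.
exists (B / gamma) => l i.
have B_ge0 : 0 <= B by apply: sumr_ge0 => j _; exact: sumr_ge0.
have F0_le : `|F 0 l i| <= B.
  rewrite /B (bigD1 i)//= (bigD1 l)//= -addrA lerDl.
  by rewrite addr_ge0 ?sumr_ge0// => j _; exact: sumr_ge0.
have A_ge0 : 0 <= B / gamma by rewrite divr_ge0 // ltW.
have /(_ i l) := Fm (const_mx (B / gamma)) 0.
rewrite !mxE subr0 [gamma * _]mulrC divfK ?gt_eqF// => Fm_il.
have : B <= F (const_mx (B / gamma)) l i - F 0 l i.
  apply: Fm_il => //.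
  have [[[j k] _ ->] _] := @fmaxP R ('I_d * 'I_N)%type predT
    (fun jk => const_mx (B / gamma) jk.2 jk.1 - (0 : 'M[R]_(N, d)) jk.2 jk.1)
    (i, l) isT.
  by rewrite /= !mxE subr0.
have := ler_norm (- F 0 l i); rewrite normrN.
by lra.
Qed.

(** * Convergence tools *)

Lemma cvg_matrix {R : realType} {N d : nat} {T : Type} {G : set_system T}
    {FG : Filter G} (U : T -> 'M[R]_(N, d)) (u : 'M[R]_(N, d)) :
  (forall l i, U x l i @[x --> G] --> u l i) -> U x @[x --> G] --> u.
Proof.
move=> cvgU A [P Pn PA].
apply: (@filterS _ _ _ (fun x => forall l i, P l i (U x l i))).
  by move=> x Px; exact: PA.
apply: filter_forall => l; apply: filter_forall => i.
exact/cvgU/Pn.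
Qed.

Lemma nondecreasing_ge0_cvg_pinfty {R : realType} (f : R -> R) (A : R) :
  (forall x y, 0 <= x -> x <= y -> f x <= f y) ->
  (forall x, 0 <= x -> f x <= A) ->
  exists a : R, f x @[x --> +oo] --> a.
Proof.
move=> f_homo f_le.
(* Freezing [f] at [f 0] on the negative axis makes it nondecreasing and bounded on all of [R],
   without changing it near [+oo]. *)
pose g x := f (Num.max 0 x).
exists (sup (range g)).
have : g x @[x --> +oo] --> sup (range g).
  apply: nondecreasing_cvgr.
    move=> x y xy; apply: f_homo; first by rewrite le_max lexx.
    by rewrite ge_max !le_max lexx xy orbT.
  by exists A => _ [x _ <-]; apply: f_le; rewrite le_max lexx.
apply: cvg_trans; apply: near_eq_cvg; near=> x.
by rewrite /g max_r.
Unshelve. all: by end_near.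
Qed.

(** * Passage to the limit in the penalty parameter *)

Section penalized_limit.
Context {R : realType} {N d : nat} (F : 'M[R]_(N, d) -> 'M[R]_(N, d)).
Context (p : R -> R) (c : R) (U : R -> 'M[R]_(N, d)).
Hypotheses (hp : is_penalty p)
  (hU : forall rho : R, 0 <= rho -> penalized_solution F p c rho (U rho)).

Lemma penalized_cvg_from_below :
  monotonicity_condition F -> 0 <= c -> exists u, cvg_from_below U u.
Proof.
move=> F_mono hc.
have U_homo rho1 rho2 : 0 <= rho2 -> rho2 <= rho1 ->
    forall l i, U rho2 l i <= U rho1 l i.
  move=> rho2_ge0 le_rho.
  apply: (penalized_comparison F p c rho1 rho2) => // l i.
    by rewrite (penalized_solutionE _ _ _ _ _ _ _ (hU _ _)).
  by rewrite (penalized_solutionE _ _ _ _ _ _ _ (hU _ (le_trans _ le_rho))).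
have [A FA] := const_mx_supersolution F F_mono.
have U_le rho l i : 0 <= rho -> U rho l i <= A.
  move=> rho_ge0.
  rewrite (_ : A = const_mx A l i); last by rewrite mxE.
  apply: (penalized_comparison F p c rho rho) => // {}l {}i.
    by rewrite (penalized_solutionE _ _ _ _ _ _ _ (hU _ _)).
  (* All gaps of a constant matrix equal [- c <= 0], so it carries no penalty. *)
  rewrite penalty_sum_eq0 ?mulr0// => j _.
  by rewrite !mxE; lra.
have ex_lim (li : 'I_N * 'I_d) :
    exists a : R, U rho li.1 li.2 @[rho --> +oo] --> a.
  apply: (nondecreasing_ge0_cvg_pinfty _ A) => [x y x0 xy|x x0].
    exact: U_homo.
  exact: U_le.
have [a cvga] := choice ex_lim.
exists (\matrix_(l, i) a (l, i)); split; first exact: U_homo.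
by apply: cvg_matrix => l i; rewrite mxE; exact: (cvga (l, i)).
Qed.

Context (u : 'M[R]_(N, d)).
Hypotheses (F_cont : continuous F) (cvgU : U rho @[rho --> +oo] --> u).

Lemma cvg_penalized_entry l i : U rho l i @[rho --> +oo] --> u l i.
Proof. exact: (continuous_cvg _ (@coord_continuous R N d l i u) cvgU). Qed.

Lemma cvg_penalized_F l i : F (U rho) l i @[rho --> +oo] --> F u l i.
Proof.
apply: (continuous_cvg _ (@coord_continuous R N d l i (F u))).
exact: (continuous_cvg _ (F_cont u) cvgU).
Qed.

Lemma cvg_penalized_gap l i j :
  U rho l j - c - U rho l i @[rho --> +oo] --> u l j - c - u l i.
Proof.
apply: cvgB (cvg_penalized_entry _ _).
by apply: cvgB (cvg_penalized_entry _ _) _; exact: cvg_cst.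
Qed.

Lemma penalized_limit_F_ge0 l i : 0 <= F u l i.
Proof.
rewrite leNgt; apply/negP => Fu_lt0.
have lt0 : \forall rho \near +oo, F (U rho) l i < 0.
  exact: (cvgr_lt _ (cvg_penalized_F l i) _ Fu_lt0).
have [rho [rho_ge0]] :=
  filter_ex (filterI (nbhs_pinfty_ge (num_real (0 : R))) lt0).
rewrite (penalized_solutionE _ _ _ _ _ _ _ (hU _ rho_ge0)) ltNge.
by rewrite mulr_ge0 ?penalty_sum_ge0.
Qed.

(** A positive limit gap would keep one penalty term above some [e / 2 > 0], so [F (U rho) l i]
    would grow at least like [rho * (e / 2)] although it converges. *)
Lemma penalized_limit_obstacle l i j : j != i -> u l j - c <= u l i.
Proof.
move=> ji; rewrite -subr_le0 leNgt; apply/negP => gap_gt0.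
have [p_cont _ _ p_pos] := hp.
set e := p (u l j - c - u l i); have e_gt0 : 0 < e by exact: p_pos.
have cvgp : p (U rho l j - c - U rho l i) @[rho --> +oo] --> e.
  exact: (continuous_cvg _ (p_cont _) (cvg_penalized_gap l i j)).
have e2_gt0 : 0 < e / 2 by rewrite divr_gt0.
have gtp : \forall rho \near +oo, e / 2 < p (U rho l j - c - U rho l i).
  by apply: (cvgr_gt e cvgp); lra.
have ltF : \forall rho \near +oo, F (U rho) l i < F u l i + 1.
  by apply: (cvgr_lt (F u l i) (cvg_penalized_F l i)); lra.
have ge0 := nbhs_pinfty_ge (num_real (0 : R)).
(* Past this threshold, [rho * (e / 2)] exceeds [F u l i + 1]. *)
have gtq := nbhs_pinfty_gt (num_real ((F u l i + 1) / (e / 2))).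
have [rho [[rho_ge0 rho_gt] [p_gt F_lt]]] :=
  filter_ex (filterI (filterI ge0 gtq) (filterI gtp ltF)).
have : F (U rho) l i < rho * (e / 2).
  by apply: lt_trans F_lt _; rewrite -ltr_pdivrMr.
apply/negP; rewrite -leNgt (penalized_solutionE _ _ _ _ _ _ _ (hU _ rho_ge0)).
apply: ler_wpM2l => //; rewrite /penalty_sum (bigD1 j)//=.
rewrite (le_trans (ltW p_gt))// lerDl.
by apply: sumr_ge0 => k _; exact: penalty_ge0.
Qed.

Lemma penalized_limit_F_eq0 l i :
  (forall j, j != i -> u l j - c < u l i) -> F u l i = 0.
Proof.
move=> gap_lt0.
have : F (U rho) l i @[rho --> +oo] --> (0 : R).
  have F0 : \forall rho \near +oo, 0 = F (U rho) l i.
    (* There are finitely many [j], so all gaps become negative simultaneously. *)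
    have gapU : \forall rho \near +oo, forall j, j != i ->
        U rho l j - c - U rho l i < 0.
      apply: filter_forall => j; have [->|ji] := eqVneq j i; first exact: nearW.
      have gap_ji : u l j - c - u l i < 0 by rewrite subr_lt0 gap_lt0.
      by apply: filterS (cvgr_lt _ (cvg_penalized_gap l i j) _ gap_ji).
    near=> rho.
    rewrite (penalized_solutionE _ _ _ _ _ _ _ (hU rho _))//.
    rewrite penalty_sum_eq0 ?mulr0// => j ji.
    rewrite -subr_le0 ltW//; move: j ji.
    by near: rho.
  exact: cvg_trans (near_eq_cvg F0) (cvg_cst _).
by move/(cvg_unique _ (cvg_penalized_F l i)); apply.
Unshelve. all: by end_near.
Qed.

Lemma penalized_limit_qvi : (2 <= d)%N -> qvi_solution F c u.
Proof.
move=> hd i; apply/matrixP => l k; rewrite !mxE.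
(* A second index makes [fmax] over [j != i] a genuine maximum rather than the default [0]. *)
have [j0 j0i] : exists j0 : 'I_d, j0 != i.
  have /card_gt0P[j] : (0 < #|predC1 i|)%N.
    by rewrite cardC1 card_ord -subn1 subn_gt0.
  by exists j.
have [[j ji maxE] maxP] := @fmaxP R _ (fun j : 'I_d => j != i)
  (fun j => u l j - c) j0 j0i.
rewrite maxE; apply/eqP; rewrite eq_le le_min penalized_limit_F_ge0 subr_ge0.
rewrite penalized_limit_obstacle// andbT ge_min.
(* Either the maximizing [j] makes the obstacle active, or the obstacle is strict for every [j] and
   [F u l i] vanishes. *)
have [//|lt_obs] := leP (u l i - (u l j - c)) 0; first by rewrite orbT.
rewrite penalized_limit_F_eq0 ?lexx// => k' k'i.
rewrite (le_lt_trans (maxP k' k'i))// maxE.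
by rewrite subr_gt0 in lt_obs.
Qed.

End penalized_limit.

Theorem theorem2p6 (R : realType) (N d : nat)
  (hN : (1 <= N)%N) (hd : (2 <= d)%N)
  (F : 'M[R]_(N, d) -> 'M[R]_(N, d))
  (F_cont : continuous F) (F_mono : monotonicity_condition F)
  (p : R -> R) (hp : is_penalty p)
  (c : R) (hc : 0 <= c)
  (U : R -> 'M[R]_(N, d))
  (hU : forall rho : R, 0 <= rho -> penalized_solution F p c rho (U rho)) :
  exists u : 'M[R]_(N, d),
    cvg_from_below U u /\ (0 < c -> qvi_solution F c u).
Proof.
have [u cvgu] := penalized_cvg_from_below F p c U hp hU F_mono hc.
exists u; split => // _.
exact: penalized_limit_qvi hp hU u F_cont cvgu.2 hd.
Qed.
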